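(* Let $p\ge 3$ be a prime and let $\mathbb{H}=(\mathbb{Z}/p\mathbb{Z})/G$ be the quotient hyperfield with $G\subseteq(\mathbb{Z}/p\mathbb{Z})^\times$ a subgroup with $|G|=2$. Then $\operatorname{gen}(\mathbb{H})=\{2,p\}$.
   Context: Let $p$ be a prime and $G$ a subgroup of $(\mathbb{Z}/p\mathbb{Z})^\times$ of size $n$. The $(p,n)$-hyperfield $\mathbb{H}=(\mathbb{Z}/p\mathbb{Z})/G$ has as elements the orbits $[a]=\{ga: g\in G\}$, $a\in\mathbb{Z}/p\mathbb{Z}$; multiplication is $[a]\odot[b]=[ab]$, and the multivalued hyperaddition is $[a]\boxplus[b]=\{[c] : [c]\subseteq\{x+y : x\in[a],\ y\in[b]\}\}$, extended to non-empty subsets $A,B$ of $\mathbb{H}$ by $A\boxplus B=\bigcup_{\alpha\in A,\beta\in B}(\alpha\boxplus\beta)$. The zero element is $0=[0]$. For a natural number $k$ and $x\in\mathbb{H}$, $kx$ denotes the set $x\boxplus x\boxplus\cdots\boxplus x$ with $k$ copies of $x$ (the empty sum being $\{0\}$). The characteristic $\operatorname{char}(\mathbb{H})$ is the additive submonoid (containing $0$) of all natural numbers $k$ such that $0\in kx$ for all $x\in\mathbb{H}$. The generating set $\operatorname{gen}(\mathbb{H})$ is the finite set $\{g_1,\dots,g_r\}$ of distinct natural numbers of minimal cardinality such that $\operatorname{char}(\mathbb{H})=\{g_1x_1+\cdots+g_rx_r : x_i\in\mathbb{Z}_{\ge0}\}$. *)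

(* Defs.v *)
From HB Require Import structures.
From mathcomp Require Import all_boot all_order all_algebra all_fingroup.
From mathcomp Require Import finmap.

Set Implicit Arguments.
Unset Strict Implicit.
Unset Printing Implicit Defensive.

Import GRing.Theory.

Local Open Scope ring_scope.

(* 'F_p is Z/pZ when p is prime, the only case of interest.  FinRing.unit_act  *)
(* is the action x, u |-> x * val u of the units, so that the orbit of a is    *)
(* [a] = {g a : g in G}.                                                       *)
Definition hcarrier (p : nat) (G : {group {unit 'F_p}}) : {set {set 'F_p}} :=
  [set orbit (FinRing.unit_action 'F_p) G a | a : 'F_p].

Definition hyperfield (p : nat) (G : {group {unit 'F_p}}) : finType :=
  {A : {set 'F_p} | A \in hcarrier G}.

Definition hclass (p : nat) (G : {group {unit 'F_p}}) (a : 'F_p) :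
    hyperfield G :=
  exist _ (orbit (FinRing.unit_action 'F_p) G a) (imset_f _ (erefl true)).

Definition hzero (p : nat) (G : {group {unit 'F_p}}) : hyperfield G :=
  hclass G 0.

Definition hadd (p : nat) (G : {group {unit 'F_p}}) (x y : hyperfield G) :
    {set hyperfield G} :=
  [set z : hyperfield G |
     val z \subset [set s + t | s in val x, t in val y]].

Definition hadd_set (p : nat) (G : {group {unit 'F_p}})
    (A B : {set hyperfield G}) : {set hyperfield G} :=
  \bigcup_(x in A) \bigcup_(y in B) hadd x y.

(* The sum is associated to the left and started from {0}, which is neutral    *)
(* for the hyperaddition.                                                      *)
Definition hmuln (p : nat) (G : {group {unit 'F_p}}) (k : nat)
    (x : hyperfield G) : {set hyperfield G} :=
  iter k (fun A => hadd_set A [set x]) [set hzero G].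

Definition hchar (p : nat) (G : {group {unit 'F_p}}) : pred nat :=
  fun k => [forall x : hyperfield G, hzero G \in hmuln k x].

Definition generates (S : {fset nat}) (C : pred nat) : Prop :=
  forall k : nat,
    k \in C <-> exists c : nat -> nat, k = (\sum_(g <- S) g * c g)%N.

(* gen(H) is encoded by its defining property: gen(H) = S0 means that S0 is    *)
(* the unique S such that is_gen G S.                                          *)
Definition is_gen (p : nat) (G : {group {unit 'F_p}}) (S : {fset nat}) : Prop :=
  generates S (hchar G) /\
  forall T : {fset nat}, generates T (hchar G) -> (#|` S| <= #|` T|)%N.

(* Main.v *)
Require Import Defs.
From mathcomp Require Import all_boot all_order all_algebra all_fingroup.
From mathcomp Require Import finmap.
From mathcomp Require Import cyclic zify.

(** A subgroup of order 2 of the units of ['F_p] is [{1, -1}], so the classes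
    are [{a, -a}] and [kx], for [x = [a]], consists of the classes of the
    [(k - 2j) a] with [0 <= j <= k].  Taking [a = 1], an odd [k] in the
    characteristic makes [p] divide the odd number [k - 2j], whose absolute
    value is at most [k]; hence [p <= k].  Conversely [0] lies in [0x] and [px],
    and adding [a - a] passes from [k] to [k + 2].  The characteristic is thus
    the set of all even numbers and all numbers at least [p], whose atoms [2]
    and [p] belong to every generating set. *)

Set Implicit Arguments.
Unset Strict Implicit.
Unset Printing Implicit Defensive.

Import GRing.Theory.

Local Open Scope ring_scope.

Section OrderTwo.

Variables (p : nat) (G : {group {unit 'F_p}}).
Hypotheses (hp : prime p) (hG : #|G| = 2%N).

(** The nontrivial element [v] of [G] satisfies [v ^+ 2 = 1] because the order of [G] is 2, and in a
    field the only square roots of 1 are 1 and -1. *)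
Lemma mem_group2_unit (u : {unit 'F_p}) :
  (u \in G) = (val u == 1) || (val u == -1).
Proof.
have [v vG v1] : exists2 v, v \in G & v != 1%g.
  by apply/trivgPn; rewrite trivg_card1 hG.
have eG : G :=: [set 1%g; v].
  apply/esym/eqP; rewrite eqEcard hG cards2 eq_sym v1 andbT.
  by apply/subsetP=> w; rewrite !inE => /orP[] /eqP->.
have v2 : (v ^+ 2 = 1)%g by rewrite -hG expg_cardG.
have vN : val v = -1.
  have : (val v) ^+ 2 == 1 by rewrite -FinRing.val_unitX v2.
  rewrite sqrf_eq1 => /orP[|/eqP //] /eqP v1'.
  by case/eqP: v1; apply: val_inj.
by rewrite eG !inE -vN -!val_eqE.
Qed.

Lemma mem_hclass (a c : 'F_p) :
  (c \in val (hclass G a)) = (c == a) || (c == - a).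
Proof.
apply/imsetP/orP => [[u uG ->]|[] /eqP->].
- move: uG; rewrite /= /FinRing.unit_act mem_group2_unit.
  by case/orP=> /eqP->; [left | right]; rewrite ?mulr1 ?mulrN1.
- by exists 1%g; rewrite ?group1 //= /FinRing.unit_act /= mulr1.
- have u1 : (-1 : 'F_p) \is a GRing.unit by rewrite unitrN unitr1.
  exists (FinRing.unit 'F_p u1); first by rewrite mem_group2_unit eqxx orbT.
  by rewrite /= /FinRing.unit_act /= mulrN1.
Qed.

Lemma hclassN (a : 'F_p) : hclass G (- a) = hclass G a.
Proof.
by apply: val_inj; apply/setP=> c; rewrite !mem_hclass opprK orbC.
Qed.

Lemma hclass_surj (x : hyperfield G) : exists a, x = hclass G a.
Proof.
by case: x => A AG; have /imsetP[a _ eA] := AG; exists a; apply: val_inj.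
Qed.

Lemma hadd_hclass (a b : 'F_p) :
  hclass G (a + b) \in hadd (hclass G a) (hclass G b).
Proof.
rewrite inE; apply/subsetP=> c; rewrite mem_hclass => /orP[] /eqP->.
  by apply/imset2P; exists a b; rewrite ?mem_hclass ?eqxx.
by apply/imset2P; exists (- a) (- b); rewrite ?mem_hclass ?eqxx ?orbT ?opprD.
Qed.

Lemma mem_hmulnS (k : nat) (a c : 'F_p) :
  hclass G c \in hmuln k (hclass G a) ->
  hclass G (c + a) \in hmuln k.+1 (hclass G a).
Proof.
move=> ck; apply/bigcupP; exists (hclass G c) => //.
by apply/bigcupP; exists (hclass G a); [rewrite inE | exact: hadd_hclass].
Qed.

Lemma mem_hmuln_natr (k : nat) (a : 'F_p) :
  hclass G (a *+ k) \in hmuln k (hclass G a).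
Proof.
elim: k => [|k IHk]; first by rewrite mulr0n inE.
by rewrite mulrSr mem_hmulnS.
Qed.

Lemma hzero_hmuln_add2 (k m : nat) (x : hyperfield G) :
  hzero G \in hmuln k x -> hzero G \in hmuln (m.*2 + k) x.
Proof.
have [a ->] := hclass_surj x; move=> k0; elim: m => [//|m IHm].
(* The last summand is read as the class of [- a] and the one before it as the class of [a], so that
   zero is reached as [(0 + a) - a]. *)
rewrite doubleS !addSn /hzero -(subrr a) -[in hmuln _ _]hclassN.
by rewrite mem_hmulnS // hclassN -[a in X in X \in _]add0r mem_hmulnS.
Qed.

(** Each of the [k] summands contributes 1 or -1, and [j] counts those contributing -1. *)
Lemma mem_hmuln1 (k : nat) (z : hyperfield G) (c : 'F_p) :
  z \in hmuln k (hclass G 1) -> c \in val z ->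
  exists2 j, (j <= k)%N & c = k%:R - j.*2%:R.
Proof.
elim: k z c => [|k IHk] z c.
  rewrite inE => /eqP->; rewrite mem_hclass oppr0 orbb => /eqP->.
  by exists 0%N; rewrite ?subrr.
case/bigcupP=> x xk /bigcupP[y]; rewrite !inE => /eqP-> /subsetP zxy /zxy.
case/imset2P=> s t /(IHk _ _ xk)[j jk ->].
rewrite mem_hclass => /orP[] /eqP-> ->.
  by exists j; [exact: leqW | rewrite mulrSr addrAC].
exists j.+1 => //.
by rewrite doubleS !mulrSr !opprD !addrA (addrAC k%:R 1) addrK.
Qed.

Lemma hcharE (k : nat) : (3 <= p)%N ->
  (k \in hchar G) = ~~ odd k || (p <= k)%N.
Proof.
move=> p3; have p_odd : odd p by case: (even_prime hp) p3 => [->|].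
apply/forallP/idP => [k0|k0 x].
- have [|j jk] := mem_hmuln1 (c := 0) (k0 (hclass G 1)).
    by rewrite mem_hclass eqxx.
  case k_odd: (odd k) => //= /esym/eqP; rewrite subr_eq0 => /eqP e.
  have pF n : (n%:R == 0 :> 'F_p) = (p %| n)%N.
    by rewrite (dvdn_pcharf (pchar_Fp hp)).
  (* Subtraction on [nat] truncates, so the two signs of [k - 2j] are treated apart. In both cases
     the difference is odd, hence positive, and at most [k] since [j <= k]; being divisible by [p],
     it forces [p <= k]. *)
  have [jk2|kj2] := leqP j.*2 k.
    have : (p %| k - j.*2)%N by rewrite -pF natrB // e subrr.
    by move/dvdn_leq; lia.
  have : (p %| j.*2 - k)%N by rewrite -pF natrB ?e ?subrr // ltnW.
  by move/dvdn_leq; lia.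
- have [k_odd|k_even] := boolP (odd k); last first.
    rewrite -(even_halfK k_even) -[_.*2]addn0.
    by apply: hzero_hmuln_add2; rewrite inE.
  rewrite k_odd /= in k0.
  have -> : k = ((k - p)./2.*2 + p)%N by lia.
  apply: hzero_hmuln_add2; have [a ->] := hclass_surj x.
  by have := mem_hmuln_natr p a; rewrite -mulr_natr pchar_Fp_0 // mulr0.
Qed.

End OrderTwo.

Lemma generates_mem (T : {fset nat}) (C : pred nat) (g : nat) :
  generates T C -> g \in T -> g \in C.
Proof.
move=> TC gT; apply/TC; exists (fun h => nat_of_bool (h == g)).
rewrite (big_fsetD1 g) //= eqxx muln1 big1_fset ?addn0 // => h.
by rewrite !inE => /andP[/negPf-> _] _; rewrite muln0.
Qed.

Lemma term_le_sum (T : {fset nat}) (F : nat -> nat) (g : nat) :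
  g \in T -> (F g <= \sum_(h <- T) F h)%N.
Proof. by move=> gT; rewrite (big_fsetD1 g) //= leq_addr. Qed.

Lemma odd_sum_term (T : {fset nat}) (F : nat -> nat) :
  odd (\sum_(h <- T) F h) -> exists2 g, g \in T & odd (F g).
Proof.
move=> F_odd; apply/hasP; apply: contraLR F_odd => /hasPn F_even.
rewrite big_seq; elim/big_rec: _ => // h n hT n_even.
by rewrite oddD (negPf (F_even h hT)).
Qed.

Lemma generates_even_or_ge (p : nat) (C : pred nat) : odd p ->
  (forall k, (k \in C) = ~~ odd k || (p <= k)%N) ->
  generates [fset 2%N; p]%fset C.
Proof.
move=> p_odd CE k; rewrite CE.
have p_neq2 : (p == 2%N) = false by apply: contraTF p_odd => /eqP->.
have sumE c : (\sum_(g <- [fset 2; p]%fset) g * c g = 2 * c 2 + p * c p)%N.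
  by rewrite big_fsetU1 ?inE ?big_seq_fset1 // eq_sym p_neq2.
split=> [kC|[c ->]]; last first.
  (* If [c p] vanishes the sum is even; otherwise it is at least [p]. *)
  rewrite sumE oddD !oddM p_odd /=; have [->//|cp_gt0] := posnP (c p).
  by rewrite (leq_trans (leq_pmulr p cp_gt0)) ?leq_addl ?orbT.
(* An even [k] is a multiple of 2; an odd [k] in [C] is [p] plus the even number [k - p]. *)
exists (fun g => if g == 2%N then (if odd k then (k - p)./2 else k./2)
                 else nat_of_bool (odd k)).
rewrite sumE eqxx p_neq2.
by case: ifP; lia.
Qed.

Lemma even_or_ge_sub_generators (p : nat) (C : pred nat) (T : {fset nat}) :
  odd p -> (3 <= p)%N -> (forall k, (k \in C) = ~~ odd k || (p <= k)%N) ->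
  generates T C -> ([fset 2%N; p] `<=` T)%fset.
Proof.
move=> p_odd p3 CE TC.
(* A nonzero term [g * c g] in a sum equal to 2 has [0 < g <= 2], and [g = 1] is excluded because 1
   is odd and below [p], hence not in [C]. *)
have T2 : 2%N \in T.
  have [c c2] : exists c : nat -> nat, 2 = (\sum_(g <- T) g * c g)%N.
    by apply/TC; rewrite CE.
  have [/eqP|] := posnP (\sum_(g <- T) g * c g)%N; first by rewrite -c2.
  rewrite lt0n sum_nat_seq_neq0 => /hasP[g gT /=].
  rewrite muln_eq0 negb_or -!lt0n => /andP[g_gt0 c_gt0].
  have := term_le_sum (fun g => g * c g)%N gT; rewrite -c2.
  move/(leq_trans (leq_pmulr g c_gt0)) => g_le.
  have := generates_mem TC gT; rewrite CE => gC.
  by have <- : g = 2%N by lia.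
(* Since [p] is odd, some term [g * c g] is odd. Its factor [g] is then odd and in [C], so [p <= g],
   while [g] is at most the whole sum [p]. *)
have Tp : p \in T.
  have [c cp] : exists c : nat -> nat, p = (\sum_(g <- T) g * c g)%N.
    by apply/TC; rewrite CE leqnn orbT.
  have [|g gT] := @odd_sum_term T (fun g => g * c g)%N; first by rewrite -cp.
  rewrite oddM => /andP[g_odd c_odd].
  have := term_le_sum (fun g => g * c g)%N gT; rewrite -cp.
  move/(leq_trans (leq_pmulr g (odd_gt0 c_odd))) => g_le.
  have := generates_mem TC gT; rewrite CE g_odd /= => p_le.
  by have <- : g = p by lia.
by apply/fsubsetP=> g; rewrite !inE => /orP[] /eqP->.
Qed.

Theorem theorem7 (p : nat) (hp : prime p) (hp3 : (3 <= p)%N)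
    (G : {group {unit 'F_p}}) (hG : #|G| = 2%N) (S : {fset nat}) :
  is_gen G S <-> S = [fset 2%N; p]%fset.
Proof.
have p_odd : odd p by case: (even_prime hp) hp3 => [->|].
have CE k := hcharE hp hG k hp3.
have genP := generates_even_or_ge p_odd CE.
have sub T : generates T (hchar G) -> ([fset 2%N; p] `<=` T)%fset.
  exact: even_or_ge_sub_generators.
split=> [[SC Smin]|->].
  (* [S] contains 2 and [p], and minimality against the generating set they form leaves no room for
     a third element. *)
  by apply/esym/eqP; rewrite eqEfcard sub //= Smin.
by split=> // T /sub; exact: fsubset_leq_card.
Qed.
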